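(* Let $I$ be an uncountable set and let $M$ be the $I$-fold tensor product of $(M_2(\mathbb{C}),\tau)$. Then every infinite countable group $\Gamma$ admits an outer action $\alpha$ on $M$ for which no cocycle perturbation is ergodic.
   Context: Here $\tau$ is the normalized trace on $M_2(\mathbb{C})$ and the $I$-fold tensor product is the von Neumann algebraic infinite tensor product with respect to $\tau$ (a II$_1$ factor). An action $\alpha$ of a discrete group $\Gamma$ on a factor $M$ is outer if $\alpha_g$ is not inner for every $g \neq e$, and ergodic if its fixed point algebra is $\mathbb{C}1$. A $1$-cocycle for $\alpha$ is a map $v : \Gamma \to \mathcal{U}(M)$ (the unitary group of $M$) with $v_{gh} = v_g\,\alpha_g(v_h)$ for all $g,h \in \Gamma$; the corresponding cocycle perturbation of $\alpha$ is the action $\operatorname{Ad} v \circ \alpha$ given by $(\operatorname{Ad} v \circ \alpha)_g = (\operatorname{Ad} v_g)\circ\alpha_g$. *)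

(* Defs.v *)
From HB Require Import structures.
From mathcomp Require Import all_boot all_order all_algebra.
From mathcomp Require Import complex.
From mathcomp Require Import all_classical all_reals all_analysis.

Set Implicit Arguments.
Unset Strict Implicit.
Unset Printing Implicit Defensive.

Import Order.TTheory GRing.Theory Num.Theory.
Import numFieldNormedType.Exports.

Local Open Scope classical_set_scope.
Local Open Scope ring_scope.
Local Open Scope complex_scope.
Local Open Scope sesquilinear_scope.

(* The inner product is linear in its first variable and conjugate-linear in
   its second one. *)
HB.mixin Record CompleteNormedModule_isHilbert (R : realType) H
    of CompleteNormedModule R[i] H := {
  inner_product : {dot H for (@Num.conj R[i])};
  inner_product_norm : forall xi : H, inner_product xi xi = `|xi| ^+ 2
}.

#[short(type="hilbertType")]
HB.structure Definition Hilbert (R : realType) :=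
  {H of CompleteNormedModule_isHilbert R H & CompleteNormedModule R[i] H}.

Notation "''[' u , v ]" := (inner_product u v) : ring_scope.

(* Operators on H are plain functions H -> H, so that equality, sums and scalar
   multiples are pointwise and the product is composition; an algebra of
   operators is a set M of such functions. *)
Section VonNeumannAlgebras.
Context {R : realType} {H : hilbertType R}.
Local Notation op := (H -> H).
Implicit Types (a b u : op) (S M : set op) (f : op -> op).

Definition bounded_op : set op :=
  [set a | linear a /\ exists k : R[i], forall xi, `|a xi| <= k * `|xi| ].

Definition is_adjoint a b := forall xi eta, '[a xi, eta] = '[xi, b eta].

(* An adjoint is unique, and it exists for every bounded operator; the default
   value 0 is only taken outside bounded_op. *)
Definition adj a : op := xget (fun=> 0) [set b | is_adjoint a b].

Definition commutant S : set op :=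
  [set b | bounded_op b /\ forall a, S a -> a \o b = b \o a].

Definition vN_generated S : set op :=
  commutant (commutant (S `|` adj @` S)).

Definition scalars : set op := range (fun (c : R[i]) (xi : H) => c *: xi).

Definition unitaries M : set op :=
  [set u | [/\ M u, adj u \o u = idfun & u \o adj u = idfun] ].

(* *-automorphisms of M; the values of f outside M are irrelevant. *)
Record automorphism M f : Prop := {
  aut_bij : set_bij M M f;
  aut_linear : forall (c : R[i]) a b,
    M a -> M b -> f (c *: a + b) = c *: f a + f b;
  aut_mul : forall a b, M a -> M b -> f (a \o b) = f a \o f b;
  aut_adj : forall a, M a -> f (adj a) = adj (f a)
}.

Definition Ad u : op -> op := fun a => u \o a \o adj u.

Definition inner M f : Prop :=
  exists2 u, unitaries M u & forall a, M a -> f a = Ad u a.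

End VonNeumannAlgebras.

Section Actions.
Context {R : realType} {H : hilbertType R} {Gamma : groupType}.
Local Notation op := (H -> H).
Implicit Types (M : set op) (alpha : Gamma -> op -> op) (v : Gamma -> op).

Definition group_action M alpha : Prop :=
  (forall g, automorphism M (alpha g)) /\
  (forall g h a, M a -> alpha (g * h)%g a = alpha g (alpha h a)).

Definition outer M alpha : Prop :=
  forall g, g <> 1%g -> ~ inner M (alpha g).

Definition ergodic M alpha : Prop :=
  [set a | M a /\ forall g, alpha g a = a] = scalars.

Definition cocycle M alpha v : Prop :=
  (forall g, unitaries M (v g)) /\
  (forall g h, v (g * h)%g = v g \o alpha g (v h)).

Definition perturbation v alpha : Gamma -> op -> op :=
  fun g => Ad (v g) \o alpha g.

End Actions.

Section TensorPower.
Context {R : realType} {I : choiceType} {H : hilbertType R}.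
Local Notation matrix2 := 'M[R[i]]_2.
Implicit Types (rho : I -> matrix2 -> H -> H) (Omega : H).

Definition normalized_trace (x : matrix2) : R[i] := \tr x / 2.

(* The operator rho i_1 x_1 o ... o rho i_n x_n for
   s = [:: (i_1, x_1); ...; (i_n, x_n)]. If the i_k are distinct, it represents
   the elementary tensor with x_k in position i_k and 1 elsewhere. *)
Definition elementary rho (s : seq (I * matrix2)) : H -> H :=
  foldr (fun p a => rho p.1 p.2 \o a) idfun s.

(* (H, rho, Omega) is a GNS triple of the product state given by the normalized
   traces on the algebraic tensor product of I copies of M_2(C). A unital
   *-representation of that algebraic tensor product is given by its
   restrictions rho i to the factors, which are unital *-representations with
   commuting ranges. *)
Record GNS_product_trace rho Omega : Prop := {
  GNS_bounded : forall i x, bounded_op (rho i x);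
  GNS_linear : forall i, linear (rho i);
  GNS_one : forall i, rho i 1%:M = idfun;
  GNS_mul : forall i x y, rho i (x *m y) = rho i x \o rho i y;
  GNS_adj : forall i x, is_adjoint (rho i x) (rho i (x ^t*));
  GNS_commute : forall i j x y, i <> j ->
    rho i x \o rho j y = rho j y \o rho i x;
  GNS_state : forall s : seq (I * matrix2), uniq (map fst s) ->
    '[elementary rho s Omega, Omega] = \prod_(p <- s) normalized_trace p.2;
  GNS_cyclic :
    dense [set xi : H | exists l : seq (R[i] * seq (I * matrix2)),
      xi = \sum_(p <- l) p.1 *: elementary rho p.2 Omega]
}.

End TensorPower.

(* M is the von Neumann algebraic tensor product of I copies of (M_2(C), tau):
   the von Neumann algebra generated by the algebraic tensor product in the GNS
   representation of the product state. *)
Definition is_tensor_power (R : realType) (I : choiceType)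
    (H : hilbertType R) (M : set (H -> H)) : Prop :=
  exists (rho : I -> 'M[R[i]]_2 -> H -> H) (Omega : H),
    GNS_product_trace rho Omega /\
    M = vN_generated [set a | exists i x, a = rho i x].
Arguments is_tensor_power {R} I {H} M.

(* Main.v *)
Require Import Defs.
From mathcomp Require Import all_boot all_order all_algebra.
From mathcomp Require Import complex.
From mathcomp Require Import all_classical all_reals all_analysis.
From mathcomp Require Import ring.

Set Implicit Arguments.
Unset Strict Implicit.
Unset Printing Implicit Defensive.

Import Order.TTheory GRing.Theory Num.Theory.
Import numFieldNormedType.Exports.

Local Open Scope classical_set_scope.
Local Open Scope ring_scope.
Local Open Scope complex_scope.
Local Open Scope sesquilinear_scope.

(* Embed Gamma in I and let alpha translate the tensor factors indexed by the
   image of Gamma while fixing all the others.  If alpha_g were implemented by a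
   unitary u, then right multiplication at i and left multiplication at g i would
   agree on the vector u Omega for every i in Gamma; but u Omega is nearly
   supported on a finite set of positions, away from which these two operators
   send it to nearly orthogonal vectors.  Given a cocycle v, left and right
   multiplication at i agree on every v_g Omega for all but countably many i,
   and then v_g commutes with the i-th factor because Omega is separating.  As I
   is uncountable, some factor is fixed by alpha and commutes with all v_g, hence
   is fixed by the perturbed action.  The translations and the right
   multiplications are isometries defined on the total family of elementary
   tensors and extended by continuity. *)

(** * Bounded operators, total families and extension of isometries *)

Section HilbertSpace.
Context {R : realType} {H : hilbertType R}.
Implicit Types (xi eta : H) (a b : H -> H).

Lemma ip_sum (S T : Type) (l : seq S) (m : seq T) (c : S -> R[i]) (d : T -> R[i])
    (f : S -> H) (h : T -> H) :
  '[\sum_(s <- l) c s *: f s, \sum_(t <- m) d t *: h t] =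
  \sum_(s <- l) \sum_(t <- m) c s * ((d t)^*%R * '[f s, h t]).
Proof.
rewrite linear_sumlz; apply: eq_bigr => s _.
rewrite linearZl_LR /= linear_sumr mulr_sumr; apply: eq_bigr => t _.
by rewrite linearZr_LR.
Qed.

Lemma eq_ip_norm xi eta : '[xi, xi] = '[eta, eta] -> `|xi| = `|eta|.
Proof.
rewrite !inner_product_norm => /eqP.
by rewrite eqrXn2 // => /eqP.
Qed.

Lemma adjoint_unique a b b' : is_adjoint a b -> is_adjoint a b' -> b = b'.
Proof.
move=> ab ab'; apply/funext => eta; apply/eqP; rewrite -subr_eq0.
by rewrite -(dnorm_eq0 inner_product) linearBr /= -ab -ab' subrr.
Qed.

Lemma adjE a b : is_adjoint a b -> adj a = b.
Proof. by move=> ab; apply: xget_unique => // b' /adjoint_unique; exact. Qed.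

Lemma adj_default a : ~ (exists b, is_adjoint a b) -> adj a = fun=> 0.
Proof. by move=> na; apply: xgetPN => b ab; apply: na; exists b. Qed.

Lemma linear0_fun a : linear a -> a 0 = 0.
Proof. by move=> la; have := la (-1) 0 0; rewrite !scaleN1r addr0 oppr0 addNr. Qed.

Lemma linearD_fun a : linear a -> {morph a : x y / x + y}.
Proof. by move=> la x y; rewrite -[in LHS](scale1r x) la scale1r. Qed.

Lemma linearZ_fun a : linear a -> forall c, {morph a : x / c *: x}.
Proof.
by move=> la c x; rewrite -[in LHS](addr0 (c *: x)) la (linear0_fun la) addr0.
Qed.

Lemma linearB_fun a : linear a -> {morph a : x y / x - y}.
Proof.
move=> la x y; rewrite (linearD_fun la) -scaleN1r (linearZ_fun la).
by rewrite scaleN1r.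
Qed.

Lemma linear_sum_fun (T : Type) (l : seq T) (F : T -> H) a : linear a ->
  a (\sum_(t <- l) F t) = \sum_(t <- l) a (F t).
Proof. by move=> la; apply: (big_morph a (linearD_fun la) (linear0_fun la)). Qed.

Definition isometric a := forall xi, `|a xi| = `|xi|.

Lemma isometric_bounded a : linear a -> isometric a -> bounded_op a.
Proof. by move=> la ia; split=> //; exists 1 => xi; rewrite ia mul1r. Qed.

Lemma bounded_op_id : bounded_op (idfun : H -> H).
Proof. by apply: isometric_bounded. Qed.

Lemma bounded_op_gt0 a : bounded_op a ->
  exists2 k : R[i], 0 < k & forall xi, `|a xi| <= k * `|xi|.
Proof.
move=> [la [k ak]].
(* On the zero space the given bound says nothing about the sign of [k]; on any other space a
   nonzero vector forces [0 <= k]. *)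
have [[xi /eqP xi0]|n0] := pselect (exists xi, xi <> 0); last first.
  have H0 xi : xi = 0 by apply: contra_notP n0 => ?; exists xi.
  by exists 1 => // xi; rewrite mul1r (H0 xi) (linear0_fun la).
have k0 : 0 <= k.
  have : 0 <= k * `|xi| by apply: le_trans (ak xi).
  by rewrite pmulr_lge0 // normr_gt0.
exists (k + 1) => [|eta]; first by rewrite ltr_wpDl.
by apply: le_trans (ak eta) _; rewrite ler_wpM2r // lerDl.
Qed.

Lemma bounded_op_comp a b : bounded_op a -> bounded_op b -> bounded_op (a \o b).
Proof.
move=> ba bb; have [k k0 ak] := bounded_op_gt0 ba.
have [la _] := ba; have [lb [k' bk]] := bb.
split; first by move=> c x y /=; rewrite lb la.
exists (k * k') => xi /=; apply: le_trans (ak _) _.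
by rewrite -mulrA ler_pM2l.
Qed.

Lemma bounded_op_linear_comb (c : R[i]) a b :
  bounded_op a -> bounded_op b -> bounded_op (c *: a + b).
Proof.
move=> [la [k ak]] [lb [k' bk]]; split.
  move=> d x y; rewrite /= !fctE la lb !scalerDr !scalerA (mulrC c).
  by rewrite -!addrA; congr (_ + _); rewrite addrCA.
exists (`|c| * k + k') => xi; rewrite /= !fctE; apply: le_trans (ler_normD _ _) _.
by rewrite mulrDl lerD // normrZ -mulrA ler_wpM2l.
Qed.

Definition comb (T : Type) (e : T -> H) (l : seq (R[i] * T)) : H :=
  \sum_(p <- l) p.1 *: e p.2.

Definition total_family (T : Type) (e : T -> H) : Prop :=
  dense [set xi : H | exists l, xi = comb e l].

Lemma totalP (T : Type) (e : T -> H) : total_family e ->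
  forall xi (eps : R[i]), 0 < eps -> exists l, `|xi - comb e l| < eps.
Proof.
move=> de xi eps e0; have bo : open (ball xi eps) by exact: ball_open.
have bn : ball xi eps !=set0 by exists xi; exact: ballxx.
have [eta []] := de _ bn bo.
by rewrite -ball_normE /= => xe [l le]; exists l; rewrite -le.
Qed.

Lemma bounded_op_eq0 (T : Type) (e : T -> H) a : total_family e -> bounded_op a ->
  (forall t, a (e t) = 0) -> forall xi, a xi = 0.
Proof.
move=> te ba ae xi; have [k k0 ak] := bounded_op_gt0 ba; have [la _] := ba.
apply/eqP; apply: contraT; rewrite -normr_gt0 => axi.
have [l xl] := totalP te xi (divr_gt0 axi k0).
have : `|a xi| < `|a xi|; last by rewrite ltxx.
have al : a (comb e l) = 0.
  by rewrite linear_sum_fun // big1 // => p _; rewrite linearZ_fun // ae scaler0.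
rewrite -[X in `|X| < _](subr0 (a xi)) -al -linearB_fun //.
apply: le_lt_trans (ak _) _.
by rewrite mulrC -ltr_pdivlMr.
Qed.

Lemma bounded_op_ext (T : Type) (e : T -> H) a b : total_family e ->
  bounded_op a -> bounded_op b -> (forall t, a (e t) = b (e t)) -> a = b.
Proof.
move=> te ba bb ab; apply/funext => xi; apply/eqP; rewrite -subr_eq0; apply/eqP.
have bab : bounded_op ((-1) *: b + a) by exact: bounded_op_linear_comb.
have combE x : ((-1) *: b + a) x = a x - b x.
  by rewrite /= !fctE scaleN1r addrC.
rewrite -combE; apply: (bounded_op_eq0 te bab) => t.
by rewrite combE ab subrr.
Qed.

(* The graph of the extension is the closure of the set of pairs
   (comb e l, comb f l). *)
Section IsometricExtension.
Context {T : Type} (e f : T -> H).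
Hypothesis gram : forall s t, '[f s, f t] = '[e s, e t].
Hypothesis e_total : total_family e.

Let comb_lin (h : T -> H) c l m :
  comb h ([seq (c * p.1, p.2) | p <- l] ++ m) = c *: comb h l + comb h m.
Proof.
rewrite /comb big_cat big_map scaler_sumr; congr (_ + _).
by apply: eq_bigr => p _; rewrite scalerA.
Qed.

Let comb_norm l : `|comb f l| = `|comb e l|.
Proof.
apply: eq_ip_norm; rewrite !ip_sum; apply: eq_bigr => p _.
by apply: eq_bigr => q _; rewrite gram.
Qed.

Let comb_dist l m : `|comb f l - comb f m| = `|comb e l - comb e m|.
Proof.
have sub h : comb h m - comb h l =
    comb h ([seq ((-1) * p.1, p.2) | p <- l] ++ m).
  by rewrite comb_lin scaleN1r addrC.
by rewrite distrC sub comb_norm -sub distrC.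
Qed.

Let graph xi eta := forall eps : R[i], 0 < eps ->
  exists l, `|xi - comb e l| < eps /\ `|eta - comb f l| < eps.

(** Combinations of [e] near [xi] are near each other, and by [comb_dist] so are the corresponding
    combinations of [f]. These therefore form a Cauchy filter, and completeness of [H] supplies
    [eta]. *)
Let graph_total xi : exists eta, graph xi eta.
Proof.
pose B (eps : R[i]) := comb f @` [set l | `|xi - comb e l| < eps].
pose D := [set eps : R[i] | 0 < eps].
have FF : Filter (filter_from D B).
  apply: filter_from_filter; first by exists 1; exact: ltr01.
  move=> d d' d0 d'0.
  (* The order on [R[i]] is partial; positive elements are real, hence comparable, and so have a
     minimum. *)
  have dd' : (d >=< d')%O by rewrite real_comparable ?gtr0_real.
  exists (Num.min d d'); first by rewrite /D /= comparable_lt_min // d0.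
  move=> _ [l xl <-]; have : `|xi - comb e l| < Num.min d d' := xl.
  rewrite comparable_lt_min // => /andP[? ?].
  by split; exists l.
have PF : ProperFilter (filter_from D B).
  apply: filter_from_proper => d /= /(totalP e_total xi)[l ?].
  by exists (comb f l), l.
have cF : cauchy (filter_from D B).
  apply: cauchy_exP => d d0.
  have d20 : 0 < d / 2 by rewrite divr_gt0.
  have [l xl] := totalP e_total xi d20.
  exists (comb f l), (d / 2) => // _ [m /= xm <-].
  rewrite -ball_normE /= comb_dist.
  exact: distm_lt_splitr xl xm.
have /cvg_ex[eta Feta] : cvg (filter_from D B) by exact: cauchy_cvg.
exists eta => eps eps0.
have Fb : filter_from D B (ball eta eps) by apply: Feta; exact: nbhsx_ballx.
have FB : filter_from D B (B eps) by exists eps.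
have [y [yb [l xl ly]]] := filter_ex (filterI Fb FB).
by exists l; rewrite ly; move: yb; rewrite -ball_normE.
Qed.

Let graph_norm xi eta : graph xi eta -> `|eta| = `|xi|.
Proof.
have key (d : R[i]) (x y u v : H) :
    `|u| = `|v| -> `|x - u| < d / 2 -> `|y - v| < d / 2 -> `|x| <= `|y| + d.
  move=> uv xu yv; rewrite -(subrK u x).
  apply: (@le_trans _ _ (d / 2 + (`|y| + d / 2))).
    apply: le_trans (ler_normD _ _) (lerD (ltW xu) _).
    rewrite uv -(subrK y v) addrC; apply: le_trans (ler_normD _ _) _.
    by rewrite lerD2l distrC ltW.
  by rewrite addrCA -splitr.
move=> g; apply/eqP; rewrite eq_le; apply/andP.
by split; apply/ler_addgt0Pr => d d0; have [|l [xl yl]] := g (d / 2);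
  rewrite ?divr_gt0//; [apply: key yl xl|apply: key xl yl].
Qed.

Let graph_lin c xi eta xi' eta' : graph xi eta -> graph xi' eta' ->
  graph (c *: xi + xi') (c *: eta + eta').
Proof.
move=> g g' d d0.
have c0 : 0 < `|c| + 1 by rewrite ltr_wpDl.
have [|l [xl yl]] := g (d / 2 / (`|c| + 1)); first by rewrite !divr_gt0.
have [|m [xm ym]] := g' (d / 2); first by rewrite !divr_gt0.
exists ([seq (c * p.1, p.2) | p <- l] ++ m); rewrite !comb_lin.
have key (x x' y y' : H) : `|x - y| < d / 2 / (`|c| + 1) ->
    `|x' - y'| < d / 2 -> `|c *: x + x' - (c *: y + y')| < d.
  move=> xy xy'; rewrite opprD addrACA -scalerBr [d]splitr.
  apply: le_lt_trans (ler_normD _ _) _; apply: ler_ltD => //.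
  rewrite normrZ; move: xy; rewrite ltr_pdivlMr // => /ltW; apply: le_trans.
  by rewrite mulrC ler_wpM2l // lerDl.
by split; exact: key.
Qed.

(** By linearity the difference of two values at [xi] is a value at 0, which has norm 0. *)
Let graph_fun xi eta eta' : graph xi eta -> graph xi eta' -> eta = eta'.
Proof.
move=> g g'; have := graph_norm (graph_lin (-1) g g').
rewrite !scaleN1r addNr normr0 => /eqP; rewrite normr_eq0 addrC subr_eq0.
by move=> /eqP.
Qed.

Lemma isometric_extension :
  exists V : H -> H, [/\ linear V, isometric V & forall t, V (e t) = f t].
Proof.
have [V gV] := choice graph_total; exists V; split.
- by move=> c x y; apply: graph_fun (gV _) _; exact: graph_lin.
- by move=> x; exact: graph_norm.
- move=> t; apply: graph_fun (gV _) _ => d d0; exists [:: (1, t)].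
  by rewrite /comb !big_seq1 !scale1r !subrr normr0.
Qed.

End IsometricExtension.
End HilbertSpace.

(** * Words of local operators and the product trace *)

Section ProductTrace.
Context {R : realType} {I : choiceType} {H : hilbertType R}.
Local Notation matrix2 := 'M[R[i]]_2.
Context {rho : I -> matrix2 -> H -> H} {Omega : H}.
Hypothesis rhoP : GNS_product_trace rho Omega.
Implicit Types (s t : seq (I * matrix2)) (i j : I) (x y w : matrix2).
Implicit Types (pi : I -> I).

Local Notation elem := (elementary rho).
Local Notation ntr := (@normalized_trace R).

Definition tensor_vec s : H := elem s Omega.

Definition state s : R[i] := '[tensor_vec s, Omega].

Lemma elementary_cat s t : elem (s ++ t) = elem s \o elem t.
Proof. by elim: s => [|p s IH] //=; rewrite IH. Qed.

(* The product, in their order of occurrence, of the letters of s in position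
   i: the commutation relations bring it to the front of elem s. *)
Definition component s i : matrix2 :=
  \prod_(p <- s | p.1 == i) p.2.

Lemma component_cat s t i :
  component (s ++ t) i = component s i *m component t i.
Proof. by rewrite /component big_cat. Qed.

Lemma component_notin s i : i \notin map fst s -> component s i = 1%:M.
Proof.
elim: s => [|p s IH]; first by rewrite /component big_nil.
rewrite /= inE negb_or => /andP[ip /IH sE].
by rewrite /component big_cons eq_sym (negPf ip).
Qed.

Lemma component_filter s i j : j != i ->
  component [seq p <- s | p.1 != i] j = component s j.
Proof.
move=> ji; rewrite /component big_filter_cond; apply: eq_bigl => p.
by case: (eqVneq p.1 j) => [->|]; rewrite ?ji ?andbF.
Qed.

Lemma component_map pi s i : injective pi ->
  component (map (fun p => (pi p.1, p.2)) s) (pi i) = component s i.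
Proof.
move=> pi_inj; rewrite /component big_map /=; apply: eq_bigl => p.
by rewrite (inj_eq pi_inj).
Qed.

Lemma elementary_extract s i :
  elem s = rho i (component s i) \o elem [seq p <- s | p.1 != i].
Proof.
elim: s => [|[j x] s IH].
  by rewrite /component big_nil (GNS_one rhoP).
rewrite /component big_cons /=; case: eqVneq => [->|ji] /=.
  by rewrite (GNS_mul rhoP) {1}IH.
rewrite {1}IH; apply/funext => xi /=.
have /(congr1 (fun f => f (elem [seq p <- s | p.1 != i] xi))) :=
  GNS_commute rhoP x (component s i) (elimN eqP ji).
exact.
Qed.

(** Words may repeat positions, whereas [GNS_state] asks for distinct ones. This normal form has one
    letter for each position of [L], with 1 at the positions that do not occur in [s]. *)
Lemma elementary_normal (L : seq I) s : uniq L -> {subset map fst s <= L} ->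
  elem s = elem [seq (i, component s i) | i <- L].
Proof.
elim: L s => [|i L IH] s /=.
  by move=> _; case: s => [//|p s] /(_ p.1); rewrite mem_head => /(_ isT).
move=> /andP[iL uL] sL; rewrite (elementary_extract s i) IH //.
- congr (_ \o elem _); apply/eq_in_map => j jL.
  by rewrite component_filter //; apply: contraNneq iL => <-.
- move=> j /mapP[p]; rewrite mem_filter => /andP[pi ps ->].
  have := sL p.1 (map_f fst ps).
  by rewrite inE (negPf pi).
Qed.

Lemma state_prod (L : seq I) s : uniq L -> {subset map fst s <= L} ->
  state s = \prod_(i <- L) ntr (component s i).
Proof.
move=> uL sL; rewrite /state /tensor_vec (elementary_normal uL sL).
rewrite (GNS_state rhoP) ?big_map //.
by rewrite -map_comp map_id_in.
Qed.

(** The product state is a trace because the matrix trace is one in each position. Right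
    multiplication by a unitary is isometric for this reason. *)
Lemma state_catC s t : state (s ++ t) = state (t ++ s).
Proof.
pose L := undup (map fst (s ++ t)).
rewrite !(@state_prod L) ?undup_uniq //.
- apply: eq_bigr => i _.
  by rewrite !component_cat /normalized_trace mxtrace_mulC.
- by move=> i; rewrite mem_undup !map_cat !mem_cat orbC.
- by move=> i; rewrite mem_undup.
Qed.

Lemma state_map pi s : injective pi ->
  state (map (fun p => (pi p.1, p.2)) s) = state s.
Proof.
move=> pi_inj; pose L := undup (map fst s).
rewrite (@state_prod L s) ?undup_uniq //; last first.
  by move=> i; rewrite mem_undup.
rewrite (@state_prod (map pi L)) ?map_inj_uniq ?undup_uniq //.
  by rewrite big_map; apply: eq_bigr => i _; rewrite component_map.
move=> _ /mapP[_ /mapP[p ps ->] ->] /=.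
by apply: map_f; rewrite mem_undup; apply: map_f.
Qed.

Lemma state_eq0 s i : ntr (component s i) = 0 -> state s = 0.
Proof.
(* Adding [i] to the list makes its vanishing trace one of the factors without asking whether [i]
   occurs in [s]. *)
move=> si0; rewrite (@state_prod (undup (i :: map fst s))) ?undup_uniq //.
  rewrite (bigD1_seq i) ?undup_uniq ?mem_undup ?mem_head //=.
  by rewrite si0 mul0r.
by move=> j js; rewrite mem_undup inE js orbT.
Qed.

(** The word of the adjoint operator: letters are adjoined and their order is reversed. *)
Definition star s := rev (map (fun p => (p.1, p.2 ^t*)) s).

Lemma trmx_conjK x : (x ^t*) ^t* = x.
Proof. by apply/matrixP => i j; rewrite !mxE conjCK. Qed.

Lemma ip_elementary_r t xi eta : '[xi, elem t eta] = '[elem (star t) xi, eta].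
Proof.
elim: t xi => [|[i x] t IH] xi //=.
rewrite /star /= rev_cons -cats1 elementary_cat /= -IH.
by rewrite (GNS_adj rhoP) trmx_conjK.
Qed.

Lemma ip_tensor_vec s t :
  '[tensor_vec s, tensor_vec t] = state (star t ++ s).
Proof. by rewrite ip_elementary_r /state /tensor_vec elementary_cat. Qed.

Lemma tensor_vec_total : total_family tensor_vec.
Proof. exact: GNS_cyclic rhoP. Qed.

Lemma bounded_elementary s : bounded_op (elem s).
Proof.
elim: s => [|p s IH] /=; first exact: bounded_op_id.
exact: bounded_op_comp (GNS_bounded rhoP _ _) IH.
Qed.

Lemma star_map pi s :
  star (map (fun p => (pi p.1, p.2)) s) =
  map (fun p => (pi p.1, p.2)) (star s).
Proof. by rewrite /star map_rev -!map_comp. Qed.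

Lemma exists_shift pi : injective pi ->
  exists V : H -> H, [/\ linear V, isometric V &
    forall s, V (tensor_vec s) = tensor_vec (map (fun p => (pi p.1, p.2)) s)].
Proof.
move=> pi_inj; apply: isometric_extension tensor_vec_total => s t.
by rewrite !ip_tensor_vec star_map -map_cat state_map.
Qed.

Definition unitary_mx w := w *m w ^t* = 1%:M.

(** The Gram matrix is preserved: the word of the inner product starts with the adjoint of [w] and
    ends with [w]. Traciality moves the first letter to the end, where the two cancel. *)
Lemma exists_right_mul i w : unitary_mx w ->
  exists V : H -> H, [/\ linear V, isometric V &
    forall s, V (tensor_vec s) = tensor_vec (rcons s (i, w))].
Proof.
move=> ww; apply: isometric_extension tensor_vec_total => s t.
rewrite !ip_tensor_vec.
have -> : star (rcons t (i, w)) ++ rcons s (i, w) =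
  [:: (i, w ^t*)] ++ (star t ++ rcons s (i, w)).
  by rewrite /star map_rcons rev_rcons.
rewrite state_catC -cats1 -!catA /= /state /tensor_vec !elementary_cat /=.
have /(congr1 (fun f => f Omega)) := GNS_mul rhoP i w (w ^t*).
by rewrite ww (GNS_one rhoP) /= => <-.
Qed.

End ProductTrace.

(** * Commutants and conjugation by a surjective isometry *)

Section VonNeumann.
Context {R : realType} {H : hilbertType R}.
Implicit Types (a b V W : H -> H) (S T M : set (H -> H)) (xi eta : H).

(** Polarization: the norm of [xi + eta] determines the real part of the inner product, and
    replacing [xi] by its multiple by the imaginary unit gives the imaginary part. *)
Lemma isometric_ip V : linear V -> isometric V ->
  forall xi eta, '[V xi, V eta] = '[xi, eta].
Proof.
move=> lV iV.
have re xi eta : '[V xi, V eta] + '[V xi, V eta]^* = '[xi, eta] + '[xi, eta]^*.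
  have := congr1 (fun z => z ^+ 2) (iV (xi + eta)).
  rewrite -!inner_product_norm (linearD_fun lV) !(dnormD inner_product).
  by rewrite !inner_product_norm !iV => /addrI.
move=> xi eta; have := re xi eta; have := re ('i%R *: xi) eta.
rewrite (linearZ_fun lV) !linearZl_LR /= !rmorphM /= conjCi !mulNr -!mulrBr.
set a := '[V xi, V eta]; set b := '[xi, eta] => /(mulfI (neq0Ci _)) im re'.
have dbl (z : R[i]) : z *+ 2 = z + z^* + (z - z^*).
  by rewrite addrACA subrr addr0 mulr2n.
have : a *+ 2 = b *+ 2 by rewrite !dbl re' im.
by rewrite -(mulr_natl a) -(mulr_natl b) => /mulfI; apply; rewrite pnatr_eq0.
Qed.

Lemma isometric_adjoint V W : linear V -> isometric V -> cancel W V ->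
  is_adjoint V W.
Proof. by move=> lV iV WK xi eta; rewrite -{1}(WK eta) isometric_ip. Qed.

Lemma vN_generated_selfadjoint S : adj @` S `<=` S ->
  vN_generated S = commutant (commutant S).
Proof. by move=> SS; rewrite /vN_generated setUidl. Qed.

Lemma sub_bicommutant S : S `<=` bounded_op -> S `<=` commutant (commutant S).
Proof. by move=> bS a Sa; split; [exact: bS|move=> b [_ /(_ _ Sa)]]. Qed.

Definition conj_op V W a := V \o a \o W.

(** The operator [V b W] commutes with [a] exactly when [b] commutes with [W a V], so the hypothesis
    on [S] concerns the inverse conjugation. Two applications, with [V] and [W] exchanged, handle a
    bicommutant. *)
Lemma commutant_conj V W S : bounded_op V -> bounded_op W ->
  cancel V W -> cancel W V -> (forall a, S a -> S (conj_op W V a)) ->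
  forall b, commutant S b -> commutant S (conj_op V W b).
Proof.
move=> bV bW VK WK SW b [bb cb]; split.
  exact: bounded_op_comp (bounded_op_comp bV bb) bW.
move=> a Sa; apply/funext => xi; rewrite /conj_op /=.
have /(congr1 (fun f => V (f (W xi)))) := cb _ (SW _ Sa).
by rewrite /conj_op /= !WK.
Qed.

Lemma automorphism_conj V W M : linear V -> isometric V ->
  cancel V W -> cancel W V -> (forall a, M a -> M (conj_op V W a)) ->
  (forall a, M a -> M (conj_op W V a)) -> automorphism M (conj_op V W).
Proof.
move=> lV iV VK WK MV MW.
have cK : cancel (conj_op V W) (conj_op W V).
  by move=> a; apply/funext => xi; rewrite /conj_op /= !VK.
have cK' : cancel (conj_op W V) (conj_op V W).
  by move=> a; apply/funext => xi; rewrite /conj_op /= !WK.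
split.
- split=> //.
  + by move=> a b _ _; exact: (can_inj cK).
  + by move=> a Ma; exists (conj_op W V a) => //; exact: MW.
- by move=> c a b _ _; apply/funext => xi; rewrite /conj_op /= !fctE /= lV.
- by move=> a b _ _; apply/funext => xi; rewrite /conj_op /= VK.
- move=> a _; have VW := isometric_adjoint lV iV WK.
  have WV : is_adjoint W V.
    by move=> xi eta; rewrite -{2}(WK xi) isometric_ip.
  (* Here [M] is an arbitrary set, so [a] may have no adjoint. Then neither has its conjugate, both
     values of [adj] are the default 0, and linearity of [V] gives equality. *)
  have [[b ab]|na] := pselect (exists b, is_adjoint a b).
    rewrite (adjE ab); apply/esym/adjE => xi eta.
    by rewrite /conj_op /= VW ab WV.
  rewrite !adj_default //.
    by apply/funext => xi; rewrite /conj_op /= linear0_fun.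
  move=> [b ab]; apply: na; exists (conj_op W V b) => xi eta.
  by have := ab (V xi) (V eta); rewrite /conj_op /= VK isometric_ip // VW.
Qed.

End VonNeumann.

(** * Unitary two-by-two matrices *)

Section Reflection.
Context {R : realType}.
Local Notation matrix2 := 'M[R[i]]_2.

Definition mx2 (a b c d : R[i]) : matrix2 :=
  \matrix_(i, j) if i == ord0 then if j == ord0 then a else b
                 else if j == ord0 then c else d.

Lemma mx2P (x y : matrix2) : x ord0 ord0 = y ord0 ord0 ->
  x ord0 ord_max = y ord0 ord_max -> x ord_max ord0 = y ord_max ord0 ->
  x ord_max ord_max = y ord_max ord_max -> x = y.
Proof.
have ord2 (k : 'I_2) : k = ord0 \/ k = ord_max.
  by case: k => [[|[|]]] // ?; [left|right]; exact: val_inj.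
by move=> ? ? ? ?; apply/matrixP => i j; case: (ord2 i) (ord2 j) => -> [] ->.
Qed.

Lemma unitary_mx2 (a b c d : R[i]) :
  a * a^* + b * b^* = 1 -> a * c^* + b * d^* = 0 ->
  c * a^* + d * b^* = 0 -> c * c^* + d * d^* = 1 -> unitary_mx (mx2 a b c d).
Proof.
by move=> ? ? ? ?; apply: mx2P; rewrite !mxE !big_ord_recl big_ord0 !mxE /= addr0.
Qed.

Definition reflection : matrix2 := mx2 1 0 0 (-1).

Lemma unitary_reflection : unitary_mx reflection.
Proof.
by apply: unitary_mx2; rewrite ?rmorph0 ?rmorphN ?rmorph1 ?mulrNN
  ?mulr0 ?mul0r ?mulr1 ?addr0 ?add0r.
Qed.

Lemma trace_reflection : normalized_trace reflection = 0.
Proof.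
by rewrite /normalized_trace /mxtrace !big_ord_recl big_ord0 !mxE /= addr0 subrr
  mul0r.
Qed.

(* The four unitaries are, up to a scalar, the identity and the Pauli matrices. *)
Lemma unitary_span (P : matrix2 -> Prop) :
  (forall w, unitary_mx w -> P w) ->
  (forall c x y, P x -> P y -> P (c *: x + y)) -> forall x, P x.
Proof.
move=> Pw Plin x.
have simp := (rmorph0, rmorphN, rmorph1, mulrNN, mulr0, mul0r, mulr1, addr0,
  add0r, oppr0).
have P1 : P (mx2 1 0 0 1) by apply/Pw/unitary_mx2; rewrite ?simp.
have PZ : P (mx2 1 0 0 (-1)) by apply/Pw/unitary_mx2; rewrite ?simp.
have PX : P (mx2 0 1 1 0) by apply/Pw/unitary_mx2; rewrite ?simp.
have PY : P (mx2 0 1 (-1) 0) by apply/Pw/unitary_mx2; rewrite ?simp.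
have P0 : P 0 by have := Plin (-1) _ _ P1 P1; rewrite scaleN1r addNr.
set a := x ord0 ord0; set b := x ord0 ord_max.
set c := x ord_max ord0; set d := x ord_max ord_max.
suff -> : x = (a + d) / 2 *: mx2 1 0 0 1 + ((a - d) / 2 *: mx2 1 0 0 (-1) +
    ((b + c) / 2 *: mx2 0 1 1 0 + ((b - c) / 2 *: mx2 0 1 (-1) 0 + 0))).
  by do 4![apply: (Plin) => //].
by apply: mx2P; rewrite !mxE /= -/a -/b -/c -/d; field.
Qed.

End Reflection.

(** * Shifts and right multiplications on the tensor power *)

Section TensorAlgebra.
Context {R : realType} {I : choiceType} {H : hilbertType R}.
Local Notation matrix2 := 'M[R[i]]_2.
Context {rho : I -> matrix2 -> H -> H} {Omega : H}.
Hypothesis rhoP : GNS_product_trace rho Omega.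
Implicit Types (s t : seq (I * matrix2)) (i j : I) (x y w : matrix2).
Implicit Types (pi sigma : I -> I) (xi eta : H).

Local Notation elem := (elementary rho).
Local Notation tvec := (@tensor_vec R I H rho Omega).
Local Notation tvec_total := (tensor_vec_total rhoP).
Local Notation Z := (@reflection R).

Definition local_ops : set (H -> H) := [set a | exists i x, a = rho i x].
Local Notation M := (vN_generated local_ops).

Lemma vN_local_ops : M = commutant (commutant local_ops).
Proof.
apply: vN_generated_selfadjoint => _ [_ [i [x ->]] <-].
by exists i, (x ^t*); apply: adjE; exact: GNS_adj rhoP i x.
Qed.

Lemma vN_local i x : M (rho i x).
Proof.
rewrite vN_local_ops; apply: sub_bicommutant; last by exists i, x.
by move=> _ [j [y ->]]; exact: GNS_bounded rhoP j y.
Qed.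

Lemma vN_bounded a : M a -> bounded_op a.
Proof. by rewrite vN_local_ops => -[]. Qed.

Lemma vN_comp a b : M a -> M b -> M (a \o b).
Proof.
rewrite vN_local_ops => -[ba ca] [bb cb]; split; first exact: bounded_op_comp.
move=> c Cc; apply/funext => xi /=.
have /(congr1 (fun f => f (b xi))) /= -> := ca _ Cc.
by have /(congr1 (fun f => a (f xi))) := cb _ Cc.
Qed.

Lemma norm_unit : `|Omega| = 1.
Proof.
apply/eqP; rewrite -[_ == _](@eqrXn2 _ 2) // expr1n -inner_product_norm.
by have := GNS_state rhoP (s := [::]) isT; rewrite big_nil => <-.
Qed.

Lemma elementary_notin s i x : i \notin map fst s ->
  elem s \o rho i x = rho i x \o elem s.
Proof.
elim: s => [|[j y] s IH] //=; rewrite inE negb_or => /andP[/eqP ij /IH sE].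
apply/funext => xi /=; have /(congr1 (fun f => f xi)) /= -> := sE.
have := GNS_commute rhoP x y ij.
by move=> /(congr1 (fun f => f (elem s xi))).
Qed.

Lemma ip_local_unitary i w xi eta : unitary_mx w ->
  '[rho i w xi, rho i w eta] = '[xi, eta].
Proof.
move=> /mulmx1C ww; rewrite (GNS_adj rhoP).
have /(congr1 (fun f => f eta)) := GNS_mul rhoP i (w ^t*) w.
by rewrite ww (GNS_one rhoP) /= => <-.
Qed.

Lemma norm_local_unitary i w xi : unitary_mx w -> `|rho i w xi| = `|xi|.
Proof. by move=> ww; apply: eq_ip_norm; exact: ip_local_unitary. Qed.

(** For injective [pi], [exists_shift] provides such an operator, so the default 0 is not taken;
    totality of the tensor vectors makes it unique. *)
Definition shift pi : H -> H := xget (fun=> 0) [set V | [/\ linear V, isometric V &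
  forall s, V (tvec s) = tvec (map (fun p => (pi p.1, p.2)) s)]].

Lemma shiftP pi : injective pi -> [/\ linear (shift pi), isometric (shift pi) &
  forall s, shift pi (tvec s) = tvec (map (fun p => (pi p.1, p.2)) s)].
Proof. by move=> pi_inj; exact: xgetPex (exists_shift rhoP pi_inj). Qed.

Lemma shift_bounded pi : injective pi -> bounded_op (shift pi).
Proof. by move=> /shiftP[lV iV _]; exact: isometric_bounded. Qed.

Lemma shift_comp pi sigma : injective pi -> injective sigma ->
  shift pi \o shift sigma = shift (pi \o sigma).
Proof.
move=> pi_inj sigma_inj; have pis_inj := inj_comp pi_inj sigma_inj.
have [_ _ Vp] := shiftP pi_inj; have [_ _ Vs] := shiftP sigma_inj.
have [_ _ Vps] := shiftP pis_inj.
apply: (bounded_op_ext tvec_total) => [||s].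
- by apply: bounded_op_comp; exact: shift_bounded.
- exact: shift_bounded.
- by rewrite /= Vs Vp Vps -map_comp.
Qed.

Lemma shift_id : shift idfun = idfun.
Proof.
have [_ _ V] := shiftP (@inj_id I).
apply: (bounded_op_ext tvec_total) => [||s].
- exact: shift_bounded.
- exact: bounded_op_id.
- by rewrite V map_id_in // => -[].
Qed.

Lemma shiftK pi sigma : cancel pi sigma -> cancel sigma pi ->
  cancel (shift pi) (shift sigma).
Proof.
move=> piK sK xi; have := shift_comp (can_inj sK) (can_inj piK).
have -> : sigma \o pi = idfun by apply/funext.
by rewrite shift_id => /(congr1 (fun f => f xi)).
Qed.

Definition shift_aut pi sigma := conj_op (shift pi) (shift sigma).

(** On a tensor vector, [shift sigma] relabels the word, [rho i x] prepends a letter, and [shift pi]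
    restores the old labels while sending the new letter to position [pi i]. *)
Lemma shift_aut_local pi sigma i x : cancel pi sigma -> cancel sigma pi ->
  shift_aut pi sigma (rho i x) = rho (pi i) x.
Proof.
move=> piK sK; have pi_inj := can_inj piK; have s_inj := can_inj sK.
have [_ _ Vp] := shiftP pi_inj; have [_ _ Vs] := shiftP s_inj.
apply: (bounded_op_ext tvec_total) => [||s].
- apply: bounded_op_comp (shift_bounded s_inj).
  exact: bounded_op_comp (shift_bounded pi_inj) (GNS_bounded rhoP _ _).
- exact: GNS_bounded rhoP _ _.
- rewrite /shift_aut /conj_op /= Vs.
  have := Vp ((i, x) :: [seq (sigma p.1, p.2) | p <- s]).
  rewrite {1}/tvec /= => ->; rewrite /tensor_vec /= -map_comp map_id_in //.
  by move=> [j y] _ /=; rewrite sK.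
Qed.

Lemma shift_aut_vN pi sigma a : cancel pi sigma -> cancel sigma pi ->
  M a -> M (shift_aut pi sigma a).
Proof.
move=> piK sK; rewrite vN_local_ops.
have bp := shift_bounded (can_inj piK); have bs := shift_bounded (can_inj sK).
have pK := shiftK piK sK; have sK' := shiftK sK piK.
apply: commutant_conj => // b; apply: commutant_conj => // _ [i [x ->]].
by exists (pi i), x; exact: shift_aut_local.
Qed.

Lemma automorphism_shift pi sigma : cancel pi sigma -> cancel sigma pi ->
  automorphism M (shift_aut pi sigma).
Proof.
move=> piK sK; have [lV iV _] := shiftP (can_inj piK).
apply: automorphism_conj => //; try exact: shiftK.
- by move=> a; exact: shift_aut_vN.
- by move=> a; exact: shift_aut_vN.
Qed.

(** For unitary [w] this extends the map sending [a Omega] to [a (rho i w Omega)]. *)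
Definition right_mul i w : H -> H := xget (fun=> 0) [set V |
  [/\ linear V, isometric V & forall s, V (tvec s) = tvec (rcons s (i, w))]].

Lemma right_mulP i w : unitary_mx w -> [/\ linear (right_mul i w),
  isometric (right_mul i w) &
  forall s, right_mul i w (tvec s) = tvec (rcons s (i, w))].
Proof. by move=> ww; exact: xgetPex (exists_right_mul rhoP i ww). Qed.

Lemma right_mul_unit i w : unitary_mx w -> right_mul i w Omega = rho i w Omega.
Proof. by move=> /(right_mulP i)[_ _ /(_ [::])]. Qed.

(** Prepending a letter commutes with appending one, so [right_mul i w] lies in the commutant of the
    local operators, and [M] is their bicommutant. *)
Lemma vN_right_mul a i w : M a -> unitary_mx w ->
  a \o right_mul i w = right_mul i w \o a.
Proof.
rewrite vN_local_ops => -[_ ca] /(right_mulP i)[lV iV VE].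
have bV := isometric_bounded lV iV.
suff /ca-> : commutant local_ops (right_mul i w) by [].
split=> // _ [j [x ->]]; have bx := GNS_bounded rhoP j x.
apply: (bounded_op_ext tvec_total) => [||s].
- exact: bounded_op_comp.
- exact: bounded_op_comp.
- by have := VE ((j, x) :: s); rewrite /= VE.
Qed.

(* Omega is separating for M since it is cyclic for the right multiplications. *)
Lemma vN_separating a b : M a -> M b -> a Omega = b Omega -> a = b.
Proof.
move=> Ma Mb ab; have [la _] := vN_bounded Ma; have [lb _] := vN_bounded Mb.
apply: (bounded_op_ext tvec_total); [exact: vN_bounded..|].
(* The induction appends letters on the right: a unitary letter is a right multiplication, which
   commutes with [a] and [b], and [unitary_span] passes to all matrices. *)
elim/last_ind => [//|s [i x] IH].
have vE y : tvec (rcons s (i, y)) = elem s (rho i y Omega).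
  by rewrite /tensor_vec -cats1 elementary_cat.
move: x; apply: unitary_span => [w ww|c x y].
  have [_ _ <-] := right_mulP i ww.
  have /(congr1 (fun f => f (tvec s))) /= -> := vN_right_mul i Ma ww.
  have /(congr1 (fun f => f (tvec s))) /= -> := vN_right_mul i Mb ww.
  by rewrite IH.
have [ls _] := bounded_elementary rhoP s.
by rewrite !vE (GNS_linear rhoP) !fctE ls la lb => -> ->.
Qed.

(** * Approximation by finitely supported vectors and outerness of shifts *)

Definition support (l : seq (R[i] * seq (I * matrix2))) : seq I :=
  flatten [seq map fst p.2 | p <- l].

Lemma notin_support l p i : i \notin support l -> p \in l ->
  i \notin map fst p.2.
Proof.
move=> il pl; apply: contra il => ip.
by apply/flattenP; exists (map fst p.2) => //; exact: map_f.
Qed.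

(** A letter in a position that no word of [l] uses can be moved from the end of each word to its
    front. *)
Lemma local_right_mul_comb l i w : unitary_mx w -> i \notin support l ->
  right_mul i w (comb tvec l) = rho i w (comb tvec l).
Proof.
move=> ww il; have [lV _ VE] := right_mulP i ww.
have [lr _] := GNS_bounded rhoP i w.
rewrite !linear_sum_fun //; apply: eq_big_seq => p pl.
rewrite !linearZ_fun // VE /tensor_vec -cats1 elementary_cat.
congr (_ *: _).
exact: (congr1 (fun f => f Omega) (elementary_notin w (notin_support il pl))).
Qed.

(** Left and right multiplication are isometric and agree on a combination within [eps / 2] of [xi],
    away from its finite support. *)
Lemma right_mul_approx w xi (eps : R[i]) : unitary_mx w -> 0 < eps ->
  exists F : seq I, forall i, i \notin F ->
    `|right_mul i w xi - rho i w xi| < eps.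
Proof.
move=> ww eps0; have eps20 : 0 < eps / 2 by rewrite divr_gt0.
have [l xl] := totalP tvec_total xi eps20.
exists (support l) => i il.
have [lV iV _] := right_mulP i ww; have [lr _] := GNS_bounded rhoP i w.
rewrite -(subrK (comb tvec l) xi) (linearD_fun lV) (linearD_fun lr).
rewrite local_right_mul_comb // opprD addrACA subrr addr0 [eps]splitr.
apply: le_lt_trans (ler_normB _ _) _.
by rewrite iV norm_local_unitary // ltrD.
Qed.

Lemma countable_right_mul_neq w xi : unitary_mx w ->
  countable [set i | right_mul i w xi <> rho i w xi].
Proof.
move=> ww; pose d (n : nat) : R[i] := (n.+1%:R^-1)%:C.
have d0 n : 0 < d n by rewrite ltcR invr_gt0.
have [F FP] := choice (fun n => right_mul_approx xi ww (d0 n)).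
apply: sub_countable (@bigcup_countable _ _ setT (fun n => [set` F n]) _ _).
- apply: subset_card_le => i /= neq.
  set r := `|right_mul i w xi - rho i w xi|.
  (* Positivity in [R[i]] means zero imaginary part and positive real part, so the archimedean
     property of [R] provides [n]. Hence [i] lies in the finite exceptional set for [d n]. *)
  have : 0 < r by rewrite normr_gt0 subr_eq0; exact/eqP.
  rewrite ltcE /= => /andP[/eqP Imr /ltr_add_invr[n]]; rewrite add0r => nr.
  exists n => //=; apply/negPn/negP => /FP; rewrite -/r ltcE.
  by move=> /andP[_ rn]; have := lt_trans nr rn; rewrite ltxx.
- exact: countableP.
- by move=> n _; apply: finite_set_countable; exact: finite_seq.
Qed.

(* A vector of M Omega determines the operator, so an operator commutes with
   rho i w as soon as left and right multiplication by w at i agree on its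
   vector. *)
Lemma vN_commute_local a i w : M a -> unitary_mx w ->
  right_mul i w (a Omega) = rho i w (a Omega) -> a \o rho i w = rho i w \o a.
Proof.
move=> Ma ww aE; have Mr := vN_local i w.
apply: vN_separating; [exact: vN_comp|exact: vN_comp|rewrite /=].
rewrite -right_mul_unit // -aE.
exact: (congr1 (fun f => f Omega) (vN_right_mul i Ma ww)).
Qed.

(** In every word arising from the inner product, the component at [i] is the single letter [Z],
    whose trace is 0. *)
Lemma ip_local_comb_eq0 l i j : i <> j -> i \notin support l ->
  '[rho i Z (comb tvec l), rho j Z (comb tvec l)] = 0.
Proof.
move=> ij il.
have [li _] := GNS_bounded rhoP i Z; have [lj _] := GNS_bounded rhoP j Z.
rewrite !linear_sum_fun //.
under eq_bigr do rewrite (linearZ_fun li).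
under [X in '[_, X]]eq_bigr do rewrite (linearZ_fun lj).
rewrite ip_sum big_seq big1 // => p pl; rewrite big_seq big1 // => q ql.
have := ip_tensor_vec rhoP ((i, Z) :: p.2) ((j, Z) :: q.2).
rewrite /= {1 2}/tensor_vec /= => ->; rewrite (state_eq0 rhoP (i := i)) ?mulr0 //.
rewrite component_cat component_notin.
  rewrite mul1mx -cat1s component_cat (component_notin (notin_support il pl)).
  by rewrite mulmx1 /component big_mkcond big_seq1 eqxx trace_reflection.
rewrite /star map_rev mem_rev -map_comp /= inE negb_or; apply/andP; split.
  exact/eqP.
exact: notin_support il ql.
Qed.

Lemma shift_aut_outer pi sigma : cancel pi sigma -> cancel sigma pi ->
  infinite_set [set i | pi i <> i] -> ~ inner M (shift_aut pi sigma).
Proof.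
move=> piK sK inf [u [Mu uu _] uE]; set xi := u Omega.
have [lu _] := vN_bounded Mu.
have uZ := @unitary_reflection R.
have xi0 : 0 < `|xi|.
  rewrite normr_gt0; apply/eqP => xi0.
  have adj0 : adj u 0 = 0.
    by have := congr1 (fun f => f 0) uu; rewrite /= linear0_fun.
  have := congr1 (fun f => f Omega) uu; rewrite /= -/xi xi0 adj0 => O0.
  by have := norm_unit; rewrite -O0 normr0 => /eqP; rewrite eq_sym oner_eq0.
(* This is the relation [u \o rho i Z = rho (pi i) Z \o u] evaluated at [Omega]. *)
have right_xi i : right_mul i Z xi = rho (pi i) Z xi.
  have /(congr1 (fun f => f Omega)) /= <- := vN_right_mul i Mu uZ.
  rewrite right_mul_unit // -(shift_aut_local _ _ piK sK).
  rewrite uE; last exact: vN_local.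
  rewrite /Ad /xi /=.
  by have /(congr1 (fun f => f Omega)) /= -> := uu.
(* The estimates below give that the norm of [eta] is at most twice that of [xi - eta], so the norm
   of [xi] is at most three times the latter, hence less than three quarters of itself. *)
have c4 : 0 < `|xi| / 4 by rewrite divr_gt0.
have [l xl] := totalP tvec_total xi c4; set eta := comb tvec l in xl.
have fin : finite_set ([set` support l] `|` pi @^-1` [set` support l]).
  rewrite finite_setU; split; first exact: finite_seq.
  by apply: finite_preimage (finite_seq _) => x y _ _; exact: can_inj piK _ _.
have D0 : [set j | pi j <> j] `\`
    ([set` support l] `|` pi @^-1` [set` support l]) !=set0.
  apply/set0P/eqP => D0; apply: inf; apply: sub_finite_set fin.
  by rewrite -setD_eq0.
have [i [pii /not_orP[/negP il _]]] := D0.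
have [lV iV _] := right_mulP i uZ; have [lj _] := GNS_bounded rhoP (pi i) Z.
(* The two operators [right_mul i Z] and [rho (pi i) Z] are isometric and agree on [xi]; replacing
   [eta] by [xi] in each costs the norm of [xi - eta]. *)
have dist : `|rho i Z eta - rho (pi i) Z eta| <= `|xi - eta| + `|xi - eta|.
  rewrite -local_right_mul_comb // -/eta.
  rewrite -(subrK (rho (pi i) Z xi) (right_mul i Z eta)) -addrA.
  apply: le_trans (ler_normD _ _) _; rewrite -{1}right_xi.
  rewrite -(linearB_fun lV) iV -(linearB_fun lj) norm_local_unitary //.
  by rewrite distrC.
have orth : '[rho i Z eta, rho (pi i) Z eta] = 0.
  by apply: ip_local_comb_eq0 => // /esym.
(* By orthogonality the squared norm of the difference is twice that of [eta]. *)
have eta_le : `|eta| <= `|rho i Z eta - rho (pi i) Z eta|.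
  have nB : '[rho i Z eta - rho (pi i) Z eta, rho i Z eta - rho (pi i) Z eta] =
    '[eta, eta] + '[eta, eta].
    rewrite -{1}(ip_local_unitary i eta eta uZ).
    rewrite -(ip_local_unitary (pi i) eta eta uZ).
    exact: hnormBd orth.
  rewrite -(@ler_pXn2r _ 2) ?nnegrE // -!inner_product_norm nB lerDl.
  rewrite inner_product_norm.
  by rewrite exprn_ge0.
have : `|xi| < `|xi|; last by rewrite ltxx.
rewrite -{1}(subrK eta xi); apply: le_lt_trans (ler_normD _ _) _.
apply: le_lt_trans (lerD (lexx _) (le_trans eta_le dist)) _.
apply: (@lt_trans _ _ (`|xi| / 4 + (`|xi| / 4 + `|xi| / 4))).
  by rewrite !ltrD.
have xiE : `|xi| / 4 + (`|xi| / 4 + `|xi| / 4) + `|xi| / 4 = `|xi| by field.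
by rewrite -[ltRHS]xiE ltrDl.
Qed.

(** A scalar [c] would equal the trace of [Z], which is 0, whereas [Z] is unitary. *)
Lemma local_reflection_nonscalar i : ~ scalars (rho i Z).
Proof.
move=> [c _ cE]; have st (x : matrix2) : '[rho i x Omega, Omega] = normalized_trace x.
  by have := GNS_state rhoP (s := [:: (i, x)]) isT; rewrite big_seq1.
have := st Z; rewrite trace_reflection -cE linearZl_LR /=.
rewrite inner_product_norm norm_unit expr1n mulr1 => c0.
have := norm_local_unitary i Omega (@unitary_reflection R).
by rewrite -cE c0 scale0r normr0 norm_unit => /eqP; rewrite eq_sym oner_eq0.
Qed.

End TensorAlgebra.

(** * Left translation on an embedded copy of the group *)

Section PartialTranslation.
Context {Gamma : groupType} {I : choiceType} (iota : Gamma -> I).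
Hypothesis iota_inj : injective iota.
Implicit Types (g h : Gamma) (i : I).

(** The default value [i] of [xget] is what fixes the points outside the range of [iota]. *)
Definition translation g i : I :=
  xget i [set j | exists2 h, i = iota h & j = iota (g * h)%g].

Lemma translation_range g h : translation g (iota h) = iota (g * h)%g.
Proof. by apply: xget_unique => [|_ [h' /iota_inj <- ->]] //; exists h. Qed.

Lemma translation_fix g i : ~ range iota i -> translation g i = i.
Proof. by move=> ni; apply: xgetPN => j [h ih _]; apply: ni; exists h. Qed.

Lemma translationM g h i :
  translation (g * h)%g i = translation g (translation h i).
Proof.
have [[k _ <-]|ni] := pselect (range iota i).
  by rewrite !translation_range mulgA.
by rewrite !translation_fix // translation_fix.
Qed.

Lemma translation1 i : translation 1%g i = i.
Proof.
have [[k _ <-]|ni] := pselect (range iota i).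
  by rewrite translation_range mul1g.
by rewrite translation_fix.
Qed.

Lemma translationK g : cancel (translation g) (translation g^-1%g).
Proof. by move=> i; rewrite -translationM mulVg translation1. Qed.

Lemma translationVK g : cancel (translation g^-1%g) (translation g).
Proof. by move=> i; rewrite -translationM mulgV translation1. Qed.

(** Left translation by [g <> 1] has no fixed point in the group, so it moves the whole infinite
    range of [iota]. *)
Lemma translation_moves g : infinite_set [set: Gamma] -> g <> 1%g ->
  infinite_set [set i | translation g i <> i].
Proof.
move=> Ginf g1 fin; apply: Ginf.
have : finite_set (iota @^-1` [set i | translation g i <> i]).
  by apply: finite_preimage fin => x y _ _ /iota_inj.
apply: sub_finite_set => h _ /=; rewrite translation_range => /iota_inj gh.
by apply: g1; apply: (mulIg h); rewrite gh mul1g.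
Qed.

End PartialTranslation.

(** * Embedding the group and choosing a fixed tensor factor *)

Lemma injective_countable_infinite (Gamma : Type) (I : Type) :
  countable [set: Gamma] -> infinite_set [set: I] ->
  exists iota : Gamma -> I, injective iota.
Proof.
move=> Gcount /infiniteP/(card_le_trans Gcount)/card_leP[f].
exists (fun g => val (f (to_setT g))) => g h /val_inj fgh.
by have /(congr1 val) := @injT _ _ f _ _ fgh.
Qed.

Theorem mainTheorem7 (R : realType) (I : choiceType)
    (I_uncountable : ~ countable [set: I]%classic)
    (H : hilbertType R) (M : set (H -> H)) (M_tensor : is_tensor_power I M)
    (Gamma : groupType)
    (Gamma_infinite : infinite_set [set: Gamma]%classic)
    (Gamma_countable : countable [set: Gamma]%classic) :
  exists alpha : Gamma -> (H -> H) -> (H -> H),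
    [/\ group_action M alpha, outer M alpha &
        forall v : Gamma -> H -> H,
          cocycle M alpha v -> ~ ergodic M (perturbation v alpha)].
Proof.
case: M_tensor => rho [xi [rhoP ->]].
have I_infinite : infinite_set [set: I].
  by move=> /finite_set_countable.
have [iota iota_inj] := injective_countable_infinite Gamma_countable I_infinite.
pose pi := translation iota.
have piK g : cancel (pi g) (pi g^-1%g) by exact: translationK.
have piVK g : cancel (pi g^-1%g) (pi g) by exact: translationVK.
have pi_inj g : injective (pi g) by exact: can_inj (piK g).
pose alpha g := @shift_aut R I H rho xi (pi g) (pi g^-1%g).
exists alpha; split.
- split=> [g|g h a _]; first exact: (automorphism_shift rhoP (piK g) (piVK g)).
  have piM x y : pi (x * y)%g = pi x \o pi y.
    by apply/funext => i; exact: translationM.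
  rewrite /alpha /shift_aut invgM !piM -!(shift_comp rhoP); try exact: pi_inj.
  by [].
- move=> g g1; apply: (shift_aut_outer rhoP (piK g) (piVK g)).
  exact: translation_moves.
- move=> v [vU _] erg; have uZ := @unitary_reflection R.
  (* Here [xi] is the cyclic vector. Outside [bad g], the reflection in position [i] commutes with
     [v g] by [vN_commute_local]. *)
  pose bad g := [set i | @right_mul R I H rho xi i reflection (v g xi) <>
    rho i reflection (v g xi)].
  have count : countable (\bigcup_b if b then range iota else \bigcup_g bad g).
    apply: bigcup_countable => [|[] _]; first exact: countableP.
      exact: sub_countable (card_image_le _ _) Gamma_countable.
    apply: bigcup_countable => // g _.
    exact: countable_right_mul_neq rhoP _ _ uZ.
  have [i ni] : exists i,
      ~ (\bigcup_b if b then range iota else \bigcup_g bad g) i.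
    apply/not_existsP => all_bad; apply: I_uncountable.
    apply: sub_countable count; apply: subset_card_le => i _.
    exact: contrapT (all_bad i).
  have nri : ~ range iota i by move=> ri; apply: ni; exists true.
  have nbi : ~ (\bigcup_g bad g) i by move=> bi; apply: ni; exists false.
  (* Ergodicity would make the reflection in position [i] a scalar, once it is shown to be fixed by
     the perturbed action. *)
  apply: (local_reflection_nonscalar rhoP (i := i)).
  rewrite -erg; split=> [|g]; first exact: (vN_local rhoP).
  have [Mv _ vv] := vU g.
  rewrite /perturbation /alpha /= (shift_aut_local rhoP _ _ (piK g) (piVK g)).
  (* Since [i] is outside the range of [iota], [alpha g] fixes the reflection; moving it past [v g]
     leaves [v g \o adj (v g)], the identity. *)
  rewrite /pi translation_fix // /Ad (vN_commute_local rhoP Mv uZ).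
    by rewrite -compA vv.
  by apply: contrapT => b; apply: nbi; exists g.
Qed.
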